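(* Let $L$ be a finite lattice which is not relatively complemented. Then there exists a family $F \subseteq L$ such that $\lvert \mathrm{Str}(F)\rvert < \lvert F\rvert$, i.e. $F$ shatters strictly fewer than $|F|$ elements of $L$.
   Context: All posets are finite. For a lattice $L$, a family (subset) $F \subseteq L$ shatters an element $y \in L$ if for every $x \le y$ in $L$ there exists $z \in F$ with $z \wedge y = x$. $\mathrm{Str}(F)$ denotes the set of all elements of $L$ shattered by $F$. For $x \le y$ in $L$, the interval is $[x,y]=\{z \in L : x \le z \le y\}$. $L$ is relatively complemented (RC) if every interval $[x,y]$, considered as a sublattice, is complemented: for every $z \in [x,y]$ there is $w \in [x,y]$ with $z \wedge w = x$ and $z \vee w = y$. By a known characterization of Björner, a finite lattice is RC if and only if it contains no $3$-element interval, i.e. there are no $x<y$ such that exactly one element $z$ satisfies $x<z<y$. *)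

(* Defs.v *)
From mathcomp Require Import all_boot all_order.
From mathcomp Require Import interval.

Set Implicit Arguments.
Unset Strict Implicit.
Unset Printing Implicit Defensive.

Local Open Scope order_scope.

Definition shatters (d : Order.disp_t) (L : finLatticeType d)
    (F : {set L}) (y : L) : bool :=
  [forall x : L, (x <= y) ==> [exists z in F, z `&` y == x]].

Definition Str (d : Order.disp_t) (L : finLatticeType d)
    (F : {set L}) : {set L} :=
  [set y : L | shatters F y].

Definition relatively_complemented (d : Order.disp_t)
    (L : finLatticeType d) : Prop :=
  forall x y : L, x <= y ->
  forall z : L, z \in `[x, y] ->
  exists w : L, [/\ w \in `[x, y], z `&` w = x & z `|` w = y].

(* Main.v *)
Require Import Defs.
From mathcomp Require Import all_boot all_order.
From mathcomp Require Import interval.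

Import Order.TTheory.

(** Call a < b < c a blocked chain when no z with a < z <= c meets b in a.

    A finite lattice without blocked chains is relatively complemented: given
    z in [x, y], take w in [x, y] maximal with z /\ w = x. If u = z \/ w were
    not y, then w < u, for u = w would force z = x and hence w = y; so the
    chain w < u < y would provide some v with w < v <= y and v /\ u = w.
    Then z /\ v = z /\ u /\ v = z /\ w = x, against the maximality of w
    ([unblocked_relatively_complemented]).

    In turn, a blocked chain a < b < c yields the family F of all z <= c
    other than a. Every element shattered by a family lies below a
    member of it, so Str F is contained in the ideal of c. It contains neither
    c nor b, because a is the only element of the ideal that meets c, or b, in
    a. Hence Str F misses two elements of the ideal where F misses only one
    ([card_Str_blocked]). *)

Local Open Scope order_scope.

Section BlockedChains.

Variables (d : Order.disp_t) (L : finLatticeType d).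
Implicit Types (a b c x y z w : L) (F : {set L}).

(** The chain a < b < c is blocked: in the interval [a, c], only the bottom
    element meets b in a. Three-element intervals are the special case where
    b is the only element strictly between a and c. *)
Definition blocked_chain a b c : bool :=
  [&& a < b, b < c & [forall z : L, (a < z <= c) ==> (z `&` b != a)]].

Lemma shattersP F y :
  reflect (forall x, x <= y -> exists2 z, z \in F & z `&` y = x)
          (shatters F y).
Proof.
apply: (iffP forallP) => [sh x le_xy | sh x].
  have /existsP[z /andP[zF /eqP zy]] := implyP (sh x) le_xy.
  by exists z.
apply/implyP => /sh[z zF zy]; apply/existsP; exists z.
by rewrite zF zy eqxx.
Qed.

Lemma shatters_below F c y :
  (forall z, z \in F -> z <= c) -> shatters F y -> y <= c.
Proof.
move=> Fc /shattersP/(_ y (lexx y))[z /Fc le_zc /meet_idPr le_yz].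
exact: le_trans le_yz le_zc.
Qed.

Lemma card_Str_blocked a b c (F := [set z : L | z <= c] :\ a) :
  blocked_chain a b c -> (#|Str F| < #|F|)%N.
Proof.
case/and3P=> lt_ab lt_bc /forallP blk.
have lt_ac := lt_trans lt_ab lt_bc.
have inF z : (z \in F) = (z != a) && (z <= c) by rewrite !inE.
have Fc z : z \in F -> z <= c by rewrite inF => /andP[].
have Nc : ~~ shatters F c.
  apply/shattersP => /(_ a (ltW lt_ac))[z]; rewrite inF => /andP[ne_za].
  by move=> /meet_idPl -> /eqP; rewrite (negPf ne_za).
have Nb : ~~ shatters F b.
  apply/shattersP => /(_ a (ltW lt_ab))[z]; rewrite inF.
  case/andP=> ne_za le_zc zb.
  have lt_az : a < z by rewrite lt_neqAle eq_sym ne_za -zb leIl.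
  by have := blk z; rewrite lt_az le_zc zb eqxx.
have bF : b \in F by rewrite inF (gt_eqF lt_ab) ltW.
have cF : c \in F :\ b.
  by rewrite in_setD1 inF (gt_eqF lt_bc) (gt_eqF lt_ac) lexx.
have sStr : Str F \subset a |: (F :\ b :\ c).
  apply/subsetP => y; rewrite inE => shy.
  rewrite in_setU1 in_setD1 in_setD1 inF (shatters_below _ _ _ Fc shy).
  have -> : y != c by apply: contraNneq Nc => <-.
  have -> : y != b by apply: contraNneq Nb => <-.
  by case: (y == a).
apply: leq_ltn_trans (subset_leq_card sStr) _.
rewrite (cardsD1 b F) (cardsD1 c (F :\ b)) bF cF cardsU1.
by rewrite !add1n ltnS -add1n leq_add2r leq_b1.
Qed.

Lemma unblocked_relatively_complemented :
  (forall a b c, ~~ blocked_chain a b c) -> relatively_complemented L.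
Proof.
move=> unblk x y le_xy z; rewrite in_itv /= => /andP[le_xz le_zy].
pose P w := [&& x <= w, w <= y & z `&` w == x].
have Px : P x by rewrite /P lexx le_xy; apply/eqP/meet_idPr.
(* Size of the principal ideal serves as a rank: it is strictly monotone, so
   a maximiser is a maximal element. *)
case: (@arg_maxnP L x P (fun w => #|[set t : L | t <= w]|) Px).
move=> w /and3P[le_xw le_wy /eqP zw] maxw.
have max_w v : P v -> ~~ (w < v).
  move=> /maxw; rewrite /= leqNgt; apply: contra => lt_wv; apply: proper_card.
  apply/properP; split.
    by apply/subsetP => t; rewrite !inE => /le_trans-> //; exact: ltW.
  by exists v; rewrite !inE ?lexx // lt_geF.
exists w; split => //; first by rewrite in_itv /= le_xw le_wy.
have le_uy : z `|` w <= y by rewrite leUx le_zy.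
apply/eqP; case: (eqVneq (z `|` w) y) => // ne_uy.
have lt_uy : z `|` w < y by rewrite lt_neqAle ne_uy.
have lt_wu : w < z `|` w.
  rewrite lt_neqAle leUr andbT; apply: contraTneq lt_uy => /esym/join_idPr le_zw.
  have Py : P y.
    by rewrite /P le_xy lexx (meet_idPl le_zy) -zw; apply/eqP/esym/meet_idPl.
  by rewrite (join_idPr le_zw) (max_w y Py).
have := unblk w (z `|` w) y; rewrite /blocked_chain lt_wu lt_uy /=.
case/forallPn=> v; rewrite negb_imply negbK => /andP[/andP[lt_wv le_vy] /eqP vu].
suff /max_w : P v by rewrite lt_wv.
rewrite /P (le_trans le_xw (ltW lt_wv)) le_vy /= -zw -vu.
by rewrite [v `&` _]meetC meetA joinKI.
Qed.

End BlockedChains.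

Theorem theorem1p3 (d : Order.disp_t) (L : finLatticeType d)
    (hL : ~ relatively_complemented L) :
  exists F : {set L}, (#|Str F| < #|F|)%N.
Proof.
case: (boolP [exists a : L, exists b : L, exists c : L, blocked_chain d L a b c]).
  case/existsP=> a /existsP[b /existsP[c /card_Str_blocked ?]].
  by exists ([set z : L | z <= c] :\ a).
move=> noblk; case: hL; apply: unblocked_relatively_complemented => a b c.
apply: contra noblk => blk.
by apply/existsP; exists a; apply/existsP; exists b; apply/existsP; exists c.
Qed.
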